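(* Consider the transitive triple, i.e. the digraph on vertices $x,y,z$ with arcs $x\to y$, $y\to z$, $x\to z$, carrying $g_1$ green pebbles on the source $x$, $g_2$ on $y$ and $g_3$ on the sink $z$ (and no other pebbles). This \textsc{blocking pebbles} position is a $\mathcal{P}$-position if and only if $g_2=g_3$.
   Context: \textsc{Blocking pebbles} with green pebbles only is an impartial game on a finite directed acyclic graph with a number of (green) pebbles on each vertex. A move by either player: choose a vertex $v$ and either (1) move a positive number of pebbles from $v$ to a single in-neighbour $u$ of $v$ (arc $u\to v$) at no cost, or (2) remove two pebbles from $v$ and place one pebble on an out-neighbour $w$ of $v$ (arc $v\to w$). Normal play (last player to move wins). A $\mathcal{P}$-position is one from which the player who is not to move (the previous player) wins. *)

(* Defs.v *)
From HB Require Import structures.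
From mathcomp Require Import all_boot.

Set Implicit Arguments.
Unset Strict Implicit.
Unset Printing Implicit Defensive.

(* Outcome classes of an impartial game under normal play; [move p q] means
   that q is an option of p.  These are least fixed points: a player "wins"
   when they can force a win in finitely many moves.  In particular a position
   without options is a P-position. *)
Inductive P_position (T : Type) (move : T -> T -> Prop) (p : T) : Prop :=
  | P_intro : (forall q, move p q -> N_position move q) -> P_position move p
with N_position (T : Type) (move : T -> T -> Prop) (p : T) : Prop :=
  | N_intro : forall q, move p q -> P_position move q -> N_position move p.

(* [arc u v] is the arc u -> v; the acyclicity condition says that a closed
   walk has no arc (so loops and 2-cycles are excluded too). *)
Record dag := Dag {
  vertex :> finType;
  arc : rel vertex;
  dag_acyclic : forall u s, path arc u s -> last u s = u -> s = [::]
}.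

Definition position (G : dag) := {ffun G -> nat}.

(* Remove a pebbles from v and put b pebbles on w (used only with v != w). *)
Definition transfer (G : dag) (p : position G) (v : G) (a : nat) (w : G)
    (b : nat) : position G :=
  [ffun t => if t == v then p t - a else if t == w then p t + b else p t].

Inductive green_move (G : dag) (p : position G) : position G -> Prop :=
  | move_to_in_neighbour (v u : G) (k : nat) :
      arc u v -> 0 < k <= p v -> green_move p (transfer p v k u k)
  | move_to_out_neighbour (v w : G) :
      arc v w -> 2 <= p v -> green_move p (transfer p v 2 w 1).

Definition vx : 'I_3 := @Ordinal 3 0 isT.
Definition vy : 'I_3 := @Ordinal 3 1 isT.
Definition vz : 'I_3 := @Ordinal 3 2 isT.

Definition triple_arc : rel 'I_3 :=
  fun u v => (u, v) \in [:: (vx, vy); (vy, vz); (vx, vz)].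

Lemma triple_arc_lt u v : triple_arc u v -> u < v.
Proof. by rewrite /triple_arc !inE => /or3P[] /eqP[-> ->]. Qed.

Lemma triple_arc_acyclic u s :
  path triple_arc u s -> last u s = u -> s = [::].
Proof.
case: s => // v s /= /andP[/triple_arc_lt uv vs] lu.
suff: v <= last v s by rewrite lu leqNgt uv.
elim: s v vs {uv lu} => //= w s IHs v /andP[/triple_arc_lt vw ws].
exact: leq_trans (ltnW vw) (IHs _ ws).
Qed.

Definition transitive_triple : dag := Dag triple_arc_acyclic.

Definition triple_position (g1 g2 g3 : nat) : position transitive_triple :=
  [ffun v : 'I_3 => if v == vx then g1 else if v == vy then g2 else g3].

(* Main.v *)
Require Import Defs.
From mathcomp Require Import all_boot zify.

(** The positions with [g2 = g3] form the kernel of the game graph.  Each move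
    from such a position changes [g2 - g3] (by [k], [2k], [1] or [3] up to
    sign), and if [g2 <> g3] the excess can be moved to the source [x].  The
    game ends because [3 g1 + 4 g2 + 5 g3] decreases along every move. *)

(** The winning move to [q] and the reply to [r] supplied by the P-proof make [r] both P and N. The
    proof of P at [r] is a subterm of that at [p], so the descent ends even if plays may be
    infinite. *)
Lemma not_P_and_N (T : Type) (move : T -> T -> Prop) (p : T) :
  P_position move p -> N_position move p -> False.
Proof.
move: p; fix IH 2 => p [Np] [q pq [Nq]].
by case: (Np q pq) => r qr Pr; apply: (IH r Pr); apply: Nq.
Qed.

Lemma P_position_kernel {T : Type} {move : T -> T -> Prop} (m : T -> nat)
    (K : pred T) :
    (forall p q, move p q -> m q < m p) ->
    (forall p q, move p q -> K p -> ~~ K q) ->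
    (forall p, ~~ K p -> exists2 q, move p q & K q) ->
  forall p, P_position move p <-> K p.
Proof.
move=> m_dec K_stable K_absorb.
(* Both outcomes are proved together, since each one at [p] rests on the other at its options. *)
have KPN n p : m p < n ->
    (K p -> P_position move p) /\ (~~ K p -> N_position move p).
  elim: n p => // n IHn p; rewrite ltnS => le_p_n.
  have IHp q : move p q -> m q < n by move/m_dec/leq_trans; apply.
  split=> [Kp | /K_absorb[q pq Kq]].
    by constructor=> q pq; apply: (proj2 (IHn q (IHp q pq))); apply: K_stable Kp.
  by apply: (N_intro pq); apply: (proj1 (IHn q (IHp q pq))).
move=> p; have [KP NKN] := KPN _ p (ltnSn _).
split=> // Pp; apply/negPn/negP => /NKN; exact: not_P_and_N.
Qed.

Lemma triple_arcP (P : 'I_3 -> 'I_3 -> Prop) :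
  P vx vy -> P vy vz -> P vx vz -> forall u v, triple_arc u v -> P u v.
Proof.
by move=> Pxy Pyz Pxz u v; rewrite /triple_arc !inE => /or3P[] /eqP[-> ->].
Qed.

(** Weights grow along arcs, so moves to in-neighbours lose weight; each is below twice any other,
    so trading two pebbles for one does too. *)
Definition triple_weight (p : position transitive_triple) : nat :=
  3 * p vx + 4 * p vy + 5 * p vz.

Lemma triple_weight_move (p q : position transitive_triple) :
  green_move p q -> triple_weight q < triple_weight p.
Proof.
rewrite /triple_weight; case=> [v u k | v w] /= vu;
  by elim/triple_arcP: _ / vu; rewrite !ffunE /=; lia.
Qed.

Lemma triple_move_neq (p q : position transitive_triple) :
  green_move p q -> p vy == p vz -> q vy != q vz.
Proof.
case=> [v u k | v w] /= vu;
  by elim/triple_arcP: _ / vu; rewrite !ffunE /=; lia.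
Qed.

Lemma triple_move_to_eq (p : position transitive_triple) :
  p vy != p vz -> exists2 q, green_move p q & q vy == q vz.
Proof.
case: (ltngtP (p vy) (p vz)) => // lt_yz _.
  exists (transfer p vz (p vz - p vy) vx (p vz - p vy)).
    by apply: move_to_in_neighbour; rewrite // subn_gt0 lt_yz leq_subr.
  by rewrite !ffunE /= subKn // ltnW.
exists (transfer p vy (p vy - p vz) vx (p vy - p vz)).
  by apply: move_to_in_neighbour; rewrite // subn_gt0 lt_yz leq_subr.
by rewrite !ffunE /= subKn // ltnW.
Qed.

Theorem theorem9 (g1 g2 g3 : nat) :
  P_position (@green_move transitive_triple) (triple_position g1 g2 g3)
    <-> g2 = g3.
Proof.
have := P_position_kernel triple_weight (fun p => p vy == p vz) triple_weight_move
  triple_move_neq triple_move_to_eq (triple_position g1 g2 g3).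
by rewrite !ffunE /= => ->; split=> [/eqP | ->].
Qed.
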